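(* Let $G$ be a connected graph and let $\widetilde{\Delta}(G)$ denote the maximum degree of a vertex of $G$ which is an endpoint of a bridge of $G$. Then $tpc(G)\leq\widetilde{\Delta}(G)+1$ if $\widetilde{\Delta}(G)\geq 4$, and $tpc(G)\leq 4$ otherwise.
   Context: All graphs are simple, finite and undirected. A graph is total-colored if every vertex and every edge receives a color. A path $v_1v_2\ldots v_s$ in a total-colored graph is a total proper path if (i) any two adjacent edges on the path have different colors, (ii) any two adjacent internal vertices of the path (vertices among $v_2,\ldots,v_{s-1}$) have different colors, and (iii) every internal vertex of the path has a color different from the colors of its two incident edges on the path. A total-colored graph is total proper connected if every two vertices are joined by a total proper path. For a connected graph $G$, the total proper connection number $tpc(G)$ is the smallest number of colors in a total-coloring making $G$ total proper connected. If $G$ has no bridge, $\widetilde{\Delta}(G)$ is taken to be $0$. *)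

(* Defs.v *)
From mathcomp Require Import all_boot.
From mathcomp Require Import boolp.

Set Implicit Arguments.
Unset Strict Implicit.
Unset Printing Implicit Defensive.

Record sgraph := SGraph {
  svertex :> finType;
  sedge : rel svertex;
  sedge_sym : symmetric sedge;
  sedge_irrefl : irreflexive sedge }.

Definition gconnected (G : sgraph) : Prop :=
  0 < #|G| /\ forall x y : G, connect (@sedge G) x y.

Definition degree (G : sgraph) (x : G) : nat := #|[set y | sedge x y]|.

Definition del_edge (G : sgraph) (u v : G) : rel G :=
  [rel x y | sedge x y && ([set x; y] != [set u; v])].

Definition bridge (G : sgraph) (u v : G) : bool :=
  sedge u v && (n_comp (@sedge G) predT < n_comp (del_edge u v) predT).

(* The maximum over an empty family is 0, so this is 0 when G is bridgeless. *)
Definition bridge_max_degree (G : sgraph) : nat :=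
  \max_(v : G | [exists w, bridge v w]) degree v.

(* A total-colouring with colours in C. The edge {x, y} is coloured by
   ecol [set x; y]; the values of ecol on sets that are not edges are
   never used. *)
Record total_coloring (G : sgraph) (C : eqType) := TotalColoring {
  vcol : G -> C;
  ecol : {set G} -> C }.

(* The path has vertex sequence v 0, v 1, ..., v (s - 1) with s = size (x :: p);
   its internal vertices are the v i with 0 < i < s - 1. *)
Definition total_proper_path (G : sgraph) (C : eqType)
    (c : total_coloring G C) (x : G) (p : seq G) : Prop :=
  let s := size (x :: p) in
  let v i := nth x (x :: p) i in
  [/\ path (@sedge G) x p && uniq (x :: p),
      forall i, i.+2 < s ->
        ecol c [set v i; v i.+1] != ecol c [set v i.+1; v i.+2],
      forall i, 0 < i -> i.+2 < s -> vcol c (v i) != vcol c (v i.+1) &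
      forall i, i.+2 < s ->
        vcol c (v i.+1) != ecol c [set v i; v i.+1] /\
        vcol c (v i.+1) != ecol c [set v i.+1; v i.+2]].

Definition total_proper_connected (G : sgraph) (C : eqType)
    (c : total_coloring G C) : Prop :=
  forall x y : G, x != y ->
    exists p, last x p = y /\ total_proper_path c x p.

Definition tpc_colorable (G : sgraph) (k : nat) : Prop :=
  exists c : total_coloring G 'I_k, total_proper_connected c.

Lemma set2_uniq3 (T : finType) (a b d : T) :
  a != b -> a != d -> [set a; b] != [set b; d].
Proof.
move=> ab ad; apply/eqP => /setP /(_ a).
by rewrite !inE eqxx (negPf ab) (negPf ad).
Qed.

Lemma tpc_colorable_ex (G : sgraph) :
  gconnected G -> exists k, `[< tpc_colorable G k >].
Proof.
move=> [_ conn]; exists #|{: G + {set G}}|; apply/asboolP.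
exists (TotalColoring (fun x : G => enum_rank (inl x : G + {set G}))
                      (fun A : {set G} => enum_rank (inr A : G + {set G}))).
move=> x y _; have /connectP[q eq_path ->] := conn x y.
case/shortenP: eq_path => p p_path p_uniq _.
have neq_v i j : i < j -> j < size (x :: p) ->
    nth x (x :: p) i != nth x (x :: p) j.
  by move=> ltij ltj; rewrite nth_uniq // ?(ltn_trans ltij) // neq_ltn ltij.
exists p; split=> //; split; first by rewrite p_path.
- move=> i lti; rewrite /ecol (inj_eq enum_rank_inj) (inj_eq (@inr_inj _ _)).
  by apply: set2_uniq3; apply: neq_v => //; apply: ltnW.
- move=> i _ lti; rewrite /vcol (inj_eq enum_rank_inj) (inj_eq (@inl_inj _ _)).
  by apply: neq_v => //; apply: ltnW.
- by move=> i _; rewrite /vcol /ecol !(inj_eq enum_rank_inj).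
Qed.

Definition tpc (G : sgraph) (hG : gconnected G) : nat :=
  ex_minn (tpc_colorable_ex hG).

(* Main.v *)
Require Import Defs.
From mathcomp Require Import all_boot.
From mathcomp Require Import boolp perm.

(** In a bridgeless component, four colours suffice for a stronger property:
    any two vertices are joined by two paths, proper also at their end vertices,
    whose first edges differ and whose last edges differ. A set with this
    property can be enlarged by any properly coloured cycle [K] that meets it: a
    path from outside that reaches [K] arrives with an edge that allows it to go
    on along [K] in at least one of the two directions. An ear, open or closed,
    can be coloured so that it completes a path of the set to such a cycle.

    A bridge ab is removed, and both sides are coloured by induction. Since the
    degrees of a and b are smaller than the number of colours, at each of them
    some colour is used neither by the vertex nor by its remaining edges. After
    permuting the colours on the side of b these two colours coincide, and give
    the colour of ab. *)

Set Implicit Arguments.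
Unset Strict Implicit.
Unset Printing Implicit Defensive.

Definition distinct {C : eqType} : rel C := fun a b => a != b.

Lemma distinct_sym (C : eqType) : symmetric (@distinct C).
Proof. by move=> a b; rewrite /distinct eq_sym. Qed.

Lemma last_rev_belast (T : Type) (x : T) p : last (last x p) (rev (belast x p)) = x.
Proof. by case: p => [|y p] //=; rewrite rev_cons last_rcons. Qed.

Lemma mem_rev_belast (T : eqType) (x : T) p : last x p :: rev (belast x p) =i x :: p.
Proof. by move=> z; rewrite -rev_rcons -lastI mem_rev. Qed.

Lemma cycle_cat_head (T : Type) (r : rel T) s x s' :
  sorted r (rcons s x) -> path r x (rcons s' (head x s)) -> cycle r (s ++ x :: s').
Proof.
case: s => [//|y s] /= path_s path_s'.
by rewrite rcons_cat -cat_rcons cat_path path_s last_rcons.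
Qed.

Lemma exists_notin (C : finType) (s : seq C) : size s < #|C| -> exists x, x \notin s.
Proof.
move=> small; case: (pickP (predC (mem s))) => [x xs|all_s]; first by exists x.
have : #|C| <= #|s| by apply/subset_leq_card/subsetP=> x _; move/negbFE: (all_s x).
by move/leq_trans/(_ (card_size s)); rewrite leqNgt small.
Qed.

Lemma exists_perm2 (T : finType) (x y x' y' : T) : x != y -> x' != y' ->
  exists2 sg : {perm T}, sg x = x' & sg y = y'.
Proof.
move=> nxy nxy'; pose y1 := tperm x x' y.
have nx'y1 : x' != y1 by rewrite -{1}(tpermL x x') (inj_eq perm_inj).
exists (tperm x x' * tperm y1 y')%g; rewrite permM; last by rewrite tpermL.
by rewrite tpermL tpermD // eq_sym.
Qed.

Lemma eq_set2 (T : finType) (x y u v : T) :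
  ([set x; y] == [set u; v]) = (x == u) && (y == v) || (x == v) && (y == u).
Proof.
apply/eqP/idP => [eq_xy|/orP[]/andP[/eqP-> /eqP->] //]; last exact: setUC.
have : [&& x \in [set u; v], y \in [set u; v], u \in [set x; y] & v \in [set x; y]].
  by rewrite -{1 2}eq_xy {3 4}eq_xy !inE !eqxx !orbT.
rewrite !inE ![u == _]eq_sym ![v == _]eq_sym.
by case: (x == u); case: (x == v); case: (y == u); case: (y == v).
Qed.

Lemma set_growth_ind (T : finType) (P : {set T} -> Prop) (A B : {set T}) :
  A \subset B -> P A ->
  (forall S : {set T}, A \subset S -> S \proper B -> P S ->
     exists S' : {set T}, [/\ S \proper S', S' \subset B & P S']) ->
  P B.
Proof.
have [n] := ubnP #|B :\: A|; elim: n => // n IHn in A *.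
rewrite ltnS => le_n subAB PA grow.
have [<-//|nAB] := eqVneq A B.
have [|S [ltAS subSB PS]] := grow A (subxx A) _ PA; first by rewrite properEneq nAB.
apply: (IHn S) => // [|S' subSS'].
  apply: leq_trans le_n; rewrite !cardsDS // ltn_sub2l ?proper_card //.
  exact: proper_sub_trans ltAS subSB.
exact: grow (subset_trans (proper_sub ltAS) subSS').
Qed.

Section Override.
Variables (I : eqType) (U : Type).
Implicit Types (f : I -> U) (s : seq I) (t : seq U).

Definition override f s t i := nth (f i) t (index i s).

Lemma override_notin f s t i : size t = size s -> i \notin s -> override f s t i = f i.
Proof. by move=> size_t iNs; rewrite /override memNindex // nth_default ?size_t. Qed.

Lemma map_override f s t : uniq s -> size t = size s -> map (override f s t) s = t.
Proof.
case: s t => [|i s] [|u t] // uniq_s size_t.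
apply: (@eq_from_nth _ u) => [|n]; rewrite size_map // => lt_n.
rewrite (nth_map i) // /override index_uniq //.
by apply: set_nth_default; rewrite size_t.
Qed.

End Override.

Section PathEdges.
Variable T : finType.
Implicit Types (x y u v : T) (p q k : seq T).

Definition path_edges x p : seq {set T} := pairmap (fun u v => [set u; v]) x p.

Lemma path_edges_cat x p q :
  path_edges x (p ++ q) = path_edges x p ++ path_edges (last x p) q.
Proof. exact: pairmap_cat. Qed.

Lemma path_edges_rcons x p y :
  path_edges x (rcons p y) = rcons (path_edges x p) [set last x p; y].
Proof. by rewrite -!cats1 path_edges_cat. Qed.

Lemma path_edges_rev x p :
  path_edges (last x p) (rev (belast x p)) = rev (path_edges x p).
Proof.
elim/last_ind: p => [//|p y IHp].
rewrite last_rcons belast_rcons path_edges_rcons rev_rcons -IHp.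
by rewrite lastI rev_rcons /= setUC.
Qed.

Lemma path_edges_subset x p S : S \in path_edges x p -> {subset S <= x :: p}.
Proof.
elim: p x => [//|y p IHp] x; rewrite inE => /predU1P[->|/IHp sub] z.
  by rewrite !inE orbA => ->.
by move/sub; rewrite [in X in _ -> X]inE => ->; rewrite orbT.
Qed.

Lemma path_edges_uniq x p : uniq (x :: p) -> uniq (path_edges x p).
Proof.
elim: p x => [//|y p IHp] x /andP[xNp uniq_p]; rewrite [uniq _]/= IHp // andbT.
by apply: contra xNp => /path_edges_subset; apply; apply: set21.
Qed.

Lemma path_edges_meet x p y S : p != [::] -> S \in path_edges x (rcons p y) ->
  exists2 z, z \in p & z \in S.
Proof.
case: p => // w p _; elim: p x w => [|w' p IHp] x w /=; rewrite inE.
  by rewrite !inE => /orP[]/eqP->; exists w; rewrite ?inE ?eqxx ?orbT.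
case/predU1P=> [->|/IHp[z zp zS]]; first by exists w; rewrite !inE eqxx ?orbT.
by exists z => //; rewrite inE zp orbT.
Qed.

Definition cycle_edges k : seq {set T} :=
  if k is x :: p then path_edges x (rcons p x) else [::].

Lemma cycle_edges_cat x p y q : cycle_edges (x :: p ++ y :: q) =
  path_edges x (rcons p y) ++ path_edges y (rcons q x).
Proof. by rewrite /= rcons_cat /= -cat_rcons path_edges_cat last_rcons. Qed.

Lemma cycle_edges_rot n k : exists m, cycle_edges (rot n k) = rot m (cycle_edges k).
Proof.
rewrite [rot n k]/rot.
case: (drop n k) (take n k) (cat_take_drop n k) => [|y q] [|x p] <-.
1-3: by exists 0; rewrite ?cats0 rot0.
exists (size (path_edges x (rcons p y))).
by rewrite !cat_cons !cycle_edges_cat rot_size_cat.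
Qed.

End PathEdges.

Section ProperPaths.
Variables (T : finType) (C : eqType) (e : rel T).
Variables (vc : T -> C) (ec : {set T} -> C).
Implicit Types (x y z w : T) (p q k : seq T) (S D A K : {set T}) (a b c d : C).

Definition colors x p : seq C := map ec (path_edges x p).

Definition good_edge : rel T :=
  [rel x y | [&& e x y, vc x != vc y, ec [set x; y] != vc x & ec [set x; y] != vc y]].

(* Unlike on a total proper path, the two end vertices also count as internal:
   two such paths can be concatenated as soon as the edges at the junction
   differ in colour. *)
Definition proper_path x p :=
  [&& path good_edge x p, uniq (x :: p) & sorted distinct (colors x p)].

Definition joined S x y :=
  exists p, [/\ proper_path x p, last x p = y & {subset x :: p <= S}].

Definition missing S a x := a != vc x /\ {in S, forall u, e u x -> ec [set u; x] != a}.

Definition proper_connected S := {in S &, forall x y, joined S x y}.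

Definition linked S a b x y := exists p s,
  [/\ proper_path x p, last x p = y, {subset x :: p <= S},
      colors x p = a :: s & last a s = b].

Definition two_linked S x y := exists a b c d,
  [/\ linked S a b x y, linked S c d x y, a != c & b != d].

Definition strong S := {in S &, forall x y, x != y -> two_linked S x y}.

Lemma colors_cat x p q : colors x (p ++ q) = colors x p ++ colors (last x p) q.
Proof. by rewrite /colors path_edges_cat map_cat. Qed.

Lemma colors_rcons x p y :
  colors x (rcons p y) = rcons (colors x p) (ec [set last x p; y]).
Proof. by rewrite /colors path_edges_rcons map_rcons. Qed.

Lemma colors_rev x p : colors (last x p) (rev (belast x p)) = rev (colors x p).
Proof. by rewrite /colors path_edges_rev map_rev. Qed.

Lemma proper_path_cat x p q :
  proper_path x p -> proper_path (last x p) q -> [disjoint x :: p & q] ->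
  sorted distinct (colors x p ++ colors (last x p) q) -> proper_path x (p ++ q).
Proof.
move=> /and3P[good_p uniq_p _] /and3P[good_q + _] disj_pq sorted_pq.
rewrite cons_uniq => /andP[_ uniq_q]; apply/and3P; split; last by rewrite colors_cat.
  by rewrite cat_path good_p.
by rewrite -cat_cons cat_uniq uniq_p uniq_q andbT -disjoint_has disjoint_sym.
Qed.

Lemma proper_path_overlap x p y q : proper_path x (rcons p y) ->
  proper_path (last x p) (y :: q) -> [disjoint x :: p & y :: q] ->
  proper_path x (p ++ y :: q).
Proof.
move=> /and3P[good_p uniq_p sorted_p] proper_q disj_pq.
move: good_p uniq_p sorted_p; rewrite -rcons_cons rcons_uniq rcons_path colors_rcons.
move=> /andP[good_p _] /andP[_ uniq_p] sorted_py.
apply: proper_path_cat disj_pq _ => //.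
  by apply/and3P; split=> //; move: sorted_py; rewrite -cats1 => /cat_sorted2[].
have /and3P[_ _ sorted_q] := proper_q.
by rewrite [colors _ (y :: q)]/= sorted_cat_cons sorted_py.
Qed.

Lemma proper_path_catl x p q : proper_path x (p ++ q) -> proper_path x p.
Proof.
case/and3P; rewrite cat_path -cat_cons cat_uniq colors_cat => /andP[good_p _].
by case/andP=> uniq_p _ /cat_sorted2[sorted_p _]; apply/and3P.
Qed.

Lemma proper_path_rcons S x p y :
  proper_path x p -> {subset x :: p <= S} -> y \notin S ->
  good_edge (last x p) y -> missing S (ec [set last x p; y]) (last x p) ->
  proper_path x (rcons p y).
Proof.
move=> /and3P[good_p uniq_p sorted_p] pS yNS good_y [_ last_neq]; apply/and3P; split.
- by rewrite rcons_path good_p.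
- by rewrite -rcons_cons rcons_uniq uniq_p andbT; apply: contra yNS => /pS.
rewrite colors_rcons.
case/lastP: p => [//|p z] in good_p uniq_p sorted_p pS good_y last_neq *.
rewrite last_rcons colors_rcons in sorted_p last_neq *.
rewrite -!cats1 -catA sorted_cat_cons sorted_p /= andbT.
move: good_p; rewrite rcons_path => /andP[_ /and4P[e_z _ _ _]].
by apply: last_neq e_z; apply: pS; rewrite -rcons_cons mem_rcons inE mem_last orbT.
Qed.

Lemma joined_refl S x : x \in S -> joined S x x.
Proof. by exists [::]; split=> // z; rewrite inE => /eqP->. Qed.

Lemma linked_joined S a b x y : linked S a b x y -> joined S x y.
Proof. by case=> p [s [proper_p last_p pS _ _]]; exists p. Qed.

Lemma joined_subset S S' x y : S \subset S' -> joined S x y -> joined S' x y.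
Proof.
by move/subsetP=> sub [p [proper_p last_p pS]]; exists p; split=> // z /pS/sub.
Qed.

Lemma linked_subset S S' a b x y :
  S \subset S' -> linked S a b x y -> linked S' a b x y.
Proof.
move/subsetP=> sub [p [s [proper_p last_p pS colors_p last_s]]].
by exists p, s; split=> // z /pS/sub.
Qed.

Lemma two_linked_subset S S' x y :
  S \subset S' -> two_linked S x y -> two_linked S' x y.
Proof.
move=> sub [a [b [c [d [link_ab link_cd nac nbd]]]]]; exists a, b, c, d.
by split=> //; apply: linked_subset sub _.
Qed.

Lemma strong_proper_connected S : strong S -> proper_connected S.
Proof.
move=> strongS x y xS yS; have [->|nxy] := eqVneq x y; first exact: joined_refl.
have [a [b [c [d [link_ab _ _ _]]]]] := strongS x y xS yS nxy.
exact: linked_joined link_ab.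
Qed.

Lemma linked_cat S S' a b c d x w y :
  linked S a b x w -> linked S' c d w y -> b != c -> S :&: S' \subset [set w] ->
  linked (S :|: S') a d x y.
Proof.
move=> [p [s [proper_p last_p pS colors_p last_s]]].
move=> [q [t [proper_q last_q qS colors_q last_t]]] nbc meet.
exists (p ++ q), (s ++ c :: t); split.
- apply: proper_path_cat; rewrite ?last_p //.
    rewrite disjoint_has; apply/hasPn => z zp; apply/negP => zq.
    have : z \in S :&: S' by rewrite inE pS // qS // inE zq orbT.
    move/(subsetP meet); rewrite inE => /eqP zw.
    by case/and3P: proper_q; rewrite /= -zw zq.
  have [/and3P[_ _ sorted_p] /and3P[_ _ sorted_q]] := (proper_p, proper_q).
  rewrite colors_p colors_q /= in sorted_p sorted_q *.
  by rewrite cat_path sorted_p /= last_s sorted_q andbT.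
- by rewrite last_cat last_p.
- move=> z; rewrite -cat_cons mem_cat in_setU => /orP[/pS->//|zq].
  by rewrite (qS z) ?orbT // inE zq orbT.
- by rewrite colors_cat last_p colors_p colors_q.
- by rewrite last_cat.
Qed.

Lemma two_linked_cat S S' c d x w y :
  two_linked S x w -> linked S' c d w y -> S :&: S' \subset [set w] ->
  exists a, linked (S :|: S') a d x y.
Proof.
move=> [a [b [a' [b' [link_ab link_ab' _ nbb']]]]] link_cd meet.
have [bc|nbc] := eqVneq b c; last first.
  by exists a; apply: linked_cat link_ab link_cd nbc meet.
by exists a'; apply: linked_cat link_ab' link_cd _ meet; rewrite -bc eq_sym.
Qed.

Lemma linked_first_hit S D a b x y : linked S a b x y -> y \in D -> x \notin D ->
  exists w c, [/\ w \in S, w \in D & linked (w |: S :\: D) a c x w].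
Proof.
move=> [p [s [proper_p last_p pS colors_p _]]] yD xND.
have hit : has (mem D) p.
  apply/hasP; exists y => //; have : y \in x :: p by rewrite -last_p mem_last.
  by rewrite inE => /predU1P[yx|//]; rewrite -yx yD in xND.
case: (split_find hit) proper_p pS colors_p {last_p}.
move=> w p1 p2 wD p1ND /proper_path_catl proper_p1 pS.
rewrite colors_cat last_rcons.
case colors_p1: (colors x (rcons p1 w)) => [|c t] //; first by case: (p1) colors_p1.
move=> [ca _]; rewrite ca in colors_p1.
exists w, (last a t); split=> //.
  by apply: pS; rewrite inE mem_cat mem_rcons mem_head orbT.
exists (rcons p1 w), t; split=> //; first by rewrite last_rcons.
move=> z; rewrite -rcons_cons mem_rcons inE => /predU1P[->|zp1]; first exact: setU11.
rewrite !inE pS ?andbT; last first.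
  by rewrite -cat_cons mem_cat -rcons_cons mem_rcons inE zp1 orbT.
by move: zp1; rewrite inE => /predU1P[->|/(hasPn p1ND)->]; rewrite ?xND orbT.
Qed.

Lemma two_linked_of_four_links S x y h l g g' a a' r r' :
  h != l -> linked S g h x y -> linked S g' l x y ->
  a != a' -> r \in [:: h; l] -> r' \in [:: h; l] ->
  linked S a r x y -> linked S a' r' x y -> two_linked S x y.
Proof.
move=> nhl link_h link_l naa' r_hl r'_hl link_a link_a'.
have [gg'|ngg'] := eqVneq g g'; last by exists g, h, g', l.
rewrite -{g'}gg' in link_l.
have [b [t [nbg t_hl link_b]]] : exists b t,
    [/\ b != g, t \in [:: h; l] & linked S b t x y].
  have [ag|nag] := eqVneq a g; last by exists a, r.
  by exists a', r'; split=> //; rewrite -ag eq_sym.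
move: t_hl link_b; rewrite !inE => /orP[]/eqP-> link_b; first by exists b, h, g, l.
by exists b, l, g, h; split; rewrite // eq_sym.
Qed.

Hypothesis e_sym : symmetric e.

Lemma good_edge_sym : symmetric good_edge.
Proof.
move=> x y; rewrite /good_edge /= e_sym setUC [vc x == _]eq_sym.
by congr [&& _, _ & _]; rewrite andbC.
Qed.

Lemma proper_path_rev x p :
  proper_path x p -> proper_path (last x p) (rev (belast x p)).
Proof.
case/and3P=> good_p uniq_p sorted_p; apply/and3P; split.
- by rewrite rev_path; apply: sub_path good_p => u v; rewrite good_edge_sym.
- by rewrite -rev_rcons -lastI rev_uniq.
rewrite colors_rev rev_sorted; apply: sub_sorted sorted_p => a b.
by rewrite distinct_sym.
Qed.

Lemma joined_sym S x y : joined S x y -> joined S y x.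
Proof.
case=> p [proper_p <- pS]; exists (rev (belast x p)); split.
- exact: proper_path_rev.
- exact: last_rev_belast.
- by move=> z; rewrite mem_rev_belast => /pS.
Qed.

Lemma linked_sym S a b x y : linked S a b x y -> linked S b a y x.
Proof.
case=> p [s [proper_p <- pS colors_p <-]].
exists (rev (belast x p)), (rev (belast a s)); split.
- exact: proper_path_rev.
- exact: last_rev_belast.
- by move=> z; rewrite mem_rev_belast => /pS.
- by rewrite colors_rev colors_p lastI rev_rcons.
- exact: last_rev_belast.
Qed.

Lemma two_linked_sym S x y : two_linked S x y -> two_linked S y x.
Proof.
case=> a [b [c [d [link_ab link_cd nac nbd]]]]; exists b, a, d, c.
by split=> //; apply: linked_sym.
Qed.

Definition proper_cycle k :=
  [&& uniq k, cycle good_edge k & cycle distinct (map ec (cycle_edges k))].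

Definition reached_two_ways S h l y := {in S, forall w, w != y -> exists u v,
  [/\ u != v, linked S u h w y & linked S v l w y]}.

Lemma proper_cycle_rot n k : proper_cycle (rot n k) = proper_cycle k.
Proof.
have [m edges_rot] := cycle_edges_rot n k.
by rewrite /proper_cycle rot_uniq rot_cycle edges_rot map_rot rot_cycle.
Qed.

Lemma proper_cycle_arc x p y q (k := x :: p ++ y :: q) : proper_cycle k ->
  linked [set z in k] (ec [set x; head y p]) (ec [set last x p; y]) x y /\
  ec [set last x p; y] != ec [set y; head x q].
Proof.
rewrite /proper_cycle {1 2}/k; case/and3P=> uniq_k /= + +.
rewrite rcons_cat /= -cat_rcons path_edges_cat last_rcons map_cat -/(colors _ _).
rewrite cat_path last_rcons => /andP[good_p _].
have [t ->] : exists t, map ec (path_edges y (rcons q x)) = ec [set y; head x q] :: t.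
  by case: (q) => [|z q'] /=; eexists.
have [s colors_p] : exists s, colors x (rcons p y) = ec [set x; head y p] :: s.
  by case: (p) => [|z p'] /=; eexists.
have last_s : last (ec [set x; head y p]) s = ec [set last x p; y].
  have := congr1 (last (ec [set x; y])) (colors_rcons x p y).
  by rewrite colors_p last_rcons.
rewrite colors_p /= rcons_path cat_path /= last_s -!andbA.
case/and4P=> sorted_p neq_py _ _.
split=> //; exists (rcons p y), s; split=> //.
- apply/and3P; split=> //; last by rewrite colors_p.
  by move: uniq_k; rewrite /k -cat_rcons -cat_cons cat_uniq => /andP[].
- by rewrite last_rcons.
by move=> z; rewrite in_set /k -cat_rcons -cat_cons mem_cat => ->.
Qed.

Lemma proper_cycle_two_arcs y p w q (k := y :: p ++ w :: q) : proper_cycle k ->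
  exists u v, [/\ u != v,
    linked [set z in k] u (ec [set y; head w p]) w y,
    linked [set z in k] v (ec [set last w q; y]) w y &
    ec [set y; head w p] != ec [set last w q; y]].
Proof.
move=> proper_k; have [/linked_sym link_yw nuv] := proper_cycle_arc proper_k.
have proper_rot : proper_cycle (w :: q ++ y :: p).
  by rewrite -(proper_cycle_rot (size (w :: q))) -cat_cons rot_size_cat.
have [link_wy nhl] := proper_cycle_arc proper_rot.
have rotK : [set z in w :: q ++ y :: p] = [set z in k].
  by apply/setP=> z; rewrite !in_set /k -!cat_cons !mem_cat orbC.
rewrite rotK in link_wy; exists (ec [set last y p; w]), (ec [set w; head y q]).
by split=> //; rewrite eq_sym.
Qed.

Lemma proper_cycle_reached k y : proper_cycle k -> y \in k ->
  exists h l, h != l /\ reached_two_ways [set z in k] h l y.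
Proof.
move=> proper_k /rot_to[i p rot_k].
have -> : [set z in k] = [set z in y :: p].
  by apply/setP=> z; rewrite !in_set -rot_k mem_rot.
rewrite -(proper_cycle_rot i) rot_k in proper_k.
have arcs w : w \in p -> exists u v, [/\ u != v,
    linked [set z in y :: p] u (ec [set y; head y p]) w y,
    linked [set z in y :: p] v (ec [set last y p; y]) w y &
    ec [set y; head y p] != ec [set last y p; y]].
  move=> wp; case/splitPr: wp proper_k => p1 p2 /proper_cycle_two_arcs.
  by rewrite last_cat; case: (p1).
case: p => [|x p] in proper_k arcs rot_k *.
  by case/and3P: proper_k => _ /andP[/and4P[_]]; rewrite eqxx.
exists (ec [set y; x]), (ec [set last x p; y]); split.
  by have [u [v []]] := arcs x (mem_head _ _).
move=> w; rewrite in_set inE => /predU1P[->|wp nwy]; first by rewrite eqxx.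
by have [u [v [nuv link_h link_l _]]] := arcs w wp; exists u, v.
Qed.

Lemma linked_setU_reached A K h l a b x y z :
  reached_two_ways K h l y -> y \notin A -> linked A a b x z -> z \in K ->
  x \notin K -> exists2 r, r \in [:: h; l] & linked (A :|: K) a r x y.
Proof.
move=> reached yNA link_xz zK xNK.
have [w [c [wA wK link_xw]]] := linked_first_hit link_xz zK xNK.
have nwy : w != y by apply: contraNneq yNA => <-.
have [u [v [nuv link_h link_l]]] := reached w wK nwy.
have sub : (w |: A :\: K) :|: K \subset A :|: K.
  rewrite !subUset sub1set in_setU wA subsetUr.
  by rewrite (subset_trans (subsetDl _ _)) ?subsetUl.
have meet : (w |: A :\: K) :&: K \subset [set w].
  by apply/subsetP=> t; rewrite !inE => /andP[/orP[->//|/andP[/negPf->]]].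
have [cu|ncu] := eqVneq c u.
  exists l; rewrite ?inE ?eqxx ?orbT //; apply: linked_subset sub _.
  by apply: linked_cat link_xw link_l _ meet; rewrite cu.
exists h; rewrite ?inE ?eqxx //; apply: linked_subset sub _.
exact: linked_cat link_xw link_h ncu meet.
Qed.

Lemma linked_setU_strong A K u l x y z : strong A -> linked K u l z y -> z \in A ->
  y \notin A -> x \in A :\: K -> exists a, linked (A :|: K) a l x y.
Proof.
move=> strongA /linked_sym link_yz zA yNA /setDP[xA xNK].
have [w [c [wK wA /linked_sym link_wy]]] := linked_first_hit link_yz zA yNA.
have nxw : x != w by apply: contraNneq xNK => ->.
have meet : A :&: (w |: K :\: A) \subset [set w].
  by apply/subsetP=> t; rewrite !inE => /andP[tA]; rewrite tA orbF.
have [a link_xy] := two_linked_cat (strongA x w xA wA nxw) link_wy meet.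
exists a; apply: linked_subset link_xy.
rewrite !subUset subsetUl sub1set in_setU wA.
by rewrite (subset_trans (subsetDl _ _)) ?subsetUr.
Qed.

(* Two paths from [x] with different first edges are continued along the cycle
   to [y], and two paths from [y] with different last edges, one in each
   direction of the cycle, are continued to [x]. *)
Lemma two_linked_setU_reached A K h l x y z :
  strong A -> h != l -> reached_two_ways K h l y -> z \in A :&: K ->
  x \in A :\: K -> y \notin A -> two_linked (A :|: K) x y.
Proof.
move=> strongA nhl reached /setIP[zA zK] xAK yNA; have [xA xNK] := setDP xAK.
have nxz : x != z by apply: contraNneq xNK => ->.
have nzy : z != y by apply: contraNneq yNA => <-.
have [u [v [_ link_h link_l]]] := reached z zK nzy.
have [g link_gh] := linked_setU_strong strongA link_h zA yNA xAK.
have [g' link_gl] := linked_setU_strong strongA link_l zA yNA xAK.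
have [a [b [a' [b' [link_xz link_xz' naa' _]]]]] := strongA x z xA zA nxz.
have [r r_hl link_r] := linked_setU_reached reached yNA link_xz zK xNK.
have [r' r'_hl link_r'] := linked_setU_reached reached yNA link_xz' zK xNK.
exact: two_linked_of_four_links nhl link_gh link_gl naa' r_hl r'_hl link_r link_r'.
Qed.

Lemma strong_setU_cycle A k z : strong A -> proper_cycle k -> z \in A -> z \in k ->
  strong (A :|: [set t in k]).
Proof.
move=> strongA proper_k zA zk; pose K := [set t in k]; rewrite -/K.
have reached y : y \in K -> exists h l, h != l /\ reached_two_ways K h l y.
  by rewrite in_set => /(proper_cycle_reached proper_k).
have zAK : z \in A :&: K by rewrite in_setI zA in_set.
have mixed x y : x \in A :\: K -> y \in K :\: A -> two_linked (A :|: K) x y.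
  move=> xAK /setDP[yK yNA].
  have [h [l [nhl reached_y]]] := reached y yK.
  exact: two_linked_setU_reached strongA nhl reached_y zAK xAK yNA.
move=> x y xAK yAK nxy.
have [/andP[xA yA]|] := boolP ((x \in A) && (y \in A)).
  by apply: two_linked_subset (subsetUl _ _) _; apply: strongA.
have [/andP[xK yK] _|] := boolP ((x \in K) && (y \in K)).
  have [h [l [nhl reached_y]]] := reached y yK.
  have [u [v [nuv link_h link_l]]] := reached_y x xK nxy.
  by apply: two_linked_subset (subsetUr _ _) _; exists u, h, v, l.
move: xAK yAK; rewrite !in_setU.
case xA: (x \in A); case xK: (x \in K);
  case yA: (y \in A); case yK: (y \in K) => //= _ _ _ _.
  by apply: mixed; rewrite inE ?xA ?xK ?yA ?yK.
by apply: two_linked_sym; apply: mixed; rewrite inE ?xA ?xK ?yA ?yK.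
Qed.

End ProperPaths.

Lemma proper_connected_subrel (T : finType) (C : eqType) (d e : rel T)
    (vc : T -> C) ec S :
  subrel d e -> proper_connected d vc ec S -> proper_connected e vc ec S.
Proof.
move=> sub_de conn x y xS yS.
have [p [/and3P[good_p uniq_p sorted_p] last_p pS]] := conn x y xS yS.
exists p; split=> //; apply/and3P; split=> //; apply: sub_path good_p => u v.
by rewrite /good_edge /= => /andP[/sub_de->].
Qed.

Section Recoloring.
Variables (T : finType) (C : eqType) (e : rel T) (sg : C -> C) (S : {set T}).
Variables (vc : T -> C) (ec : {set T} -> C) (vc' : T -> C) (ec' : {set T} -> C).

Definition recolors :=
  {in S, vc' =1 sg \o vc} /\ {in S &, forall u v, ec' [set u; v] = sg (ec [set u; v])}.

Hypotheses (sg_inj : injective sg) (rec : recolors).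

Lemma colors_recolor x p :
  {subset x :: p <= S} -> colors ec' x p = map sg (colors ec x p).
Proof.
have [_ rec_edge] := rec; elim: p x => [//|y p IHp] x pS.
rewrite /colors /=; congr (_ :: _); last first.
  by apply: IHp => z zp; apply: pS; rewrite inE zp orbT.
by apply: rec_edge; apply: pS; rewrite !inE eqxx ?orbT.
Qed.

Lemma proper_path_recolor x p : {subset x :: p <= S} ->
  proper_path e vc ec x p -> proper_path e vc' ec' x p.
Proof.
have [rec_vertex rec_edge] := rec => pS /and3P[good_p uniq_p sorted_p].
apply/and3P; split=> //.
  apply: (@sub_in_path _ [in S] _ _ _ _ _ _ good_p); last exact/allP.
  move=> u v uS vS good_uv.
  by rewrite /good_edge /= !rec_vertex // rec_edge //= !(inj_eq sg_inj).
rewrite colors_recolor // sorted_map; apply: sub_sorted sorted_p => a b.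
by rewrite /distinct /= (inj_eq sg_inj).
Qed.

Lemma proper_connected_recolor :
  proper_connected e vc ec S -> proper_connected e vc' ec' S.
Proof.
move=> conn x y xS yS; have [p [proper_p last_p pS]] := conn x y xS yS.
by exists p; split=> //; apply: proper_path_recolor.
Qed.

Lemma linked_recolor a b x y :
  linked e vc ec S a b x y -> linked e vc' ec' S (sg a) (sg b) x y.
Proof.
move=> [p [s [proper_p last_p pS colors_p last_s]]]; exists p, (map sg s).
split=> //; first exact: proper_path_recolor.
  by rewrite colors_recolor // colors_p.
by rewrite last_map last_s.
Qed.

Lemma strong_recolor : strong e vc ec S -> strong e vc' ec' S.
Proof.
move=> strongS x y xS yS nxy.
have [a [b [c [d [link_ab link_cd nac nbd]]]]] := strongS x y xS yS nxy.
exists (sg a), (sg b), (sg c), (sg d).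
by split; rewrite ?(inj_eq sg_inj) //; apply: linked_recolor.
Qed.

Lemma missing_recolor a x :
  x \in S -> missing e vc ec S a x -> missing e vc' ec' S (sg a) x.
Proof.
have [rec_vertex rec_edge] := rec => xS [nax missing_a]; split.
  by rewrite rec_vertex //= (inj_eq sg_inj).
by move=> u uS /missing_a; rewrite rec_edge // (inj_eq sg_inj); apply.
Qed.

End Recoloring.

Section ColorWalks.
Variable C : finType.
Implicit Types (v f w u : C) (t : seq (C * C)).

(* A walk of pairs lists the colour of each vertex of a path together with the
   colour of the edge leaving it. *)
Definition color_step : rel (C * C) :=
  fun s t : C * C =>
  [&& s.1 != s.2, s.1 != t.1, s.2 != t.1, s.2 != t.2 & t.1 != t.2].

Lemma exists_color_walk k v f w u : 3 < #|C| -> f != v -> u != w -> w \in [:: v; f] ->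
  exists2 t, size t = k.+1 & path color_step (v, f) (rcons t (w, u)).
Proof.
move=> C_gt3 nfv nuw wvf.
have [g gN] := @exists_notin C [:: v; f; u] C_gt3.
have [z zN] := @exists_notin C [:: v; f; g] C_gt3.
rewrite !inE in wvf; move: gN zN; rewrite !inE !negb_or.
move=> /and3P[ngv ngf ngu] /and3P[nzv nzf nzg].
have both (x y : C) : x != y -> (x != y) * (y != x).
  by move=> nxy; rewrite [y == x]eq_sym nxy.
have neq := (both _ _ nfv, both _ _ nuw, both _ _ ngv, both _ _ ngf, both _ _ ngu,
  both _ _ nzv, both _ _ nzf, both _ _ nzg).
pose walk i := exists2 t, size t = i.+1 & path color_step (v, f) (rcons t (w, u)).
(* The period-three word v f g v f g, read as three pairs, returns to (v, f). *)
have walk_add3 i : walk i -> walk i.+3.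
  case=> t size_t walk_t; exists [:: (g, v), (f, g), (v, f) & t].
    by rewrite /= size_t.
  by rewrite /= walk_t /color_step /= ?neq.
have [walk0 walk1 walk2] : [/\ walk 0, walk 1 & walk 2].
  case/orP: wvf => /eqP wE; subst w; split.
  - by exists [:: (z, g)]; rewrite //= /color_step /= ?neq.
  - by exists [:: (g, z); (f, g)]; rewrite //= /color_step /= ?neq.
  - by exists [:: (g, z); (v, f); (z, g)]; rewrite //= /color_step /= ?neq.
  - by exists [:: (z, g)]; rewrite //= /color_step /= ?neq.
  - by exists [:: (g, z); (v, g)]; rewrite //= /color_step /= ?neq.
  - by exists [:: (g, z); (f, v); (z, g)]; rewrite //= /color_step /= ?neq.
suff [] : [/\ walk k, walk k.+1 & walk k.+2] by [].
by elim: k => // i [walk_i walk_i1 walk_i2]; split=> //; apply: walk_add3.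
Qed.

End ColorWalks.

Arguments color_step {C}.

Section Ears.
Variables (T C : finType) (e : rel T).
Hypotheses (e_sym : symmetric e) (C_gt3 : 3 < #|C|).
Implicit Types (vc : T -> C) (ec : {set T} -> C) (A : {set T}).
Implicit Types (s p q : seq T) (f c : C).

Definition steps vc ec x p : seq (C * C) := zip (map vc (belast x p)) (colors ec x p).

Lemma sorted_steps_proper vc ec x p c : path e x p ->
  sorted color_step (rcons (steps vc ec x p) (vc (last x p), c)) ->
  path (good_edge e vc ec) x p /\ sorted distinct (rcons (colors ec x p) c).
Proof.
elim: p x => [//|y p IHp] x /= /andP[e_xy path_p] step_p.
have {IHp} [|good_p sorted_p] := IHp y path_p; first by move: step_p => /path_sorted.
rewrite good_p; case: p step_p sorted_p {path_p good_p} => [|z p] /andP[/and5P[/=]];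
  by rewrite /good_edge /distinct /= e_xy [ec _ == vc x]eq_sym => -> -> -> ->.
Qed.

(* [a] and [b] may coincide, but then [s] has at least two vertices, as the
   edges are distinct. *)
Definition ear A a s b := [&& a \in A, b \in A, path e a (rcons s b), uniq s,
  [disjoint s & A], s != [::] & uniq (path_edges a (rcons s b))].

Lemma ear_proper A a s b : ear A a s b -> A \proper A :|: [set z in s].
Proof.
case/and5P=> _ _ _ _ /and3P[disj_sA s_neq0 _]; rewrite properEneq subsetUl andbT.
case: s disj_sA s_neq0 => // z s; rewrite disjoint_cons => /andP[zNA _] _.
by apply: contraNneq zNA => ->; rewrite !inE eqxx orbT.
Qed.

Lemma exists_ear_recoloring vc ec A a s b f (t : seq (C * C)) :
  ear A a s b -> size t = size s -> exists vc' ec',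
  recolors id A vc ec vc' ec' /\ steps vc' ec' a (rcons s b) = (vc a, f) :: t.
Proof.
case/and5P=> aA bA _ uniq_s /and3P[disj_sA s_neq0 uniq_edges] size_t.
have sNA z : z \in A -> z \notin s by move=> zA; rewrite (disjointFl disj_sA zA).
set edges := path_edges a (rcons s b) in uniq_edges.
have edgesNA u v : u \in A -> v \in A -> [set u; v] \notin edges.
  move=> uA vA; apply/negP=> /(path_edges_meet s_neq0)[z zs].
  by rewrite !inE => /orP[]/eqP zE; move: zs; rewrite zE; apply/negP/sNA.
have size_vertices : size (unzip1 t) = size s by rewrite size_map.
have size_edges : size (f :: unzip2 t) = size edges.
  by rewrite size_pairmap size_rcons /= size_map size_t.
exists (override vc s (unzip1 t)), (override ec edges (f :: unzip2 t)).
split; first split.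
- by move=> u uA; rewrite override_notin ?sNA.
- by move=> u v uA vA; rewrite override_notin ?edgesNA.
rewrite /steps belast_rcons map_cons override_notin ?sNA // map_override //.
by rewrite /colors map_override //= zip_unzip.
Qed.

(* If [vc a != vc b], the first edge of an ear from [a] gets the colour of [b]:
   one of two paths from [b] ending with different colours at [a] allows this. *)
Lemma exists_closing_path vc ec A a b : strong e vc ec A -> a \in A -> b \in A ->
  exists f q, [/\ proper_path e vc ec b q, last b q = a, {subset b :: q <= A},
    sorted distinct (rcons (colors ec b q) f) &
    [&& f != vc a, vc b \in [:: vc a; f] & head f (colors ec b q) != vc b]].
Proof.
move=> strongA aA bA; have [->|nba] := eqVneq b a.
  have [f] := @exists_notin C [:: vc a] (ltn_trans (isT : 1 < 3) C_gt3).
  rewrite inE => nfa; exists f, [::]; split=> //; last by rewrite /= nfa !inE eqxx.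
  by move=> z; rewrite inE => /eqP->.
have [u [c [u' [c' [link_c link_c' _ ncc']]]]] := strongA b a bA aA nba.
have [f [d [d' [link_d nd'f nfa vb_af]]]] : exists f d d',
    [/\ linked e vc ec A d d' b a, d' != f, f != vc a & vc b \in [:: vc a; f]].
  have [vab|nvab] := eqVneq (vc b) (vc a).
    have [f] := @exists_notin C [:: vc a; c] (ltn_trans (isT : 2 < 3) C_gt3).
    rewrite !inE negb_or => /andP[nfa nfc]; exists f, u, c.
    by split=> //; rewrite ?vab ?inE ?eqxx // eq_sym.
  have [cb|ncb] := eqVneq c (vc b).
    exists (vc b), u', c'; split; rewrite ?inE ?eqxx ?orbT //.
    by rewrite -cb eq_sym.
  by exists (vc b), u, c; split; rewrite ?inE ?eqxx ?orbT.
have [q [t [proper_q last_q qA colors_q last_t]]] := link_d.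
have /and3P[good_q _ sorted_q] := proper_q.
exists f, q; split=> //.
  by move: sorted_q; rewrite colors_q /= rcons_path last_t => ->.
rewrite nfa vb_af colors_q /=.
case: q good_q colors_q {proper_q last_q qA sorted_q} => [//|z q] /=.
by case/andP=> /and4P[_ _ neq_vb _] _ [<-].
Qed.

Lemma proper_cycle_closed_ear vc ec A a s b q f t : ear A a s b ->
  proper_path e vc ec b q -> last b q = a -> {subset b :: q <= A} ->
  sorted distinct (rcons (colors ec b q) f) ->
  steps vc ec a (rcons s b) = (vc a, f) :: t ->
  path color_step (vc a, f) (rcons t (vc b, head f (colors ec b q))) ->
  proper_cycle e vc ec (b :: q ++ s).
Proof.
case/and5P=> _ _ path_s uniq_s /and3P[disj_sA _ _] /and3P[good_q uniq_q _].
move=> last_q qA sorted_q steps_s walk_t.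
have [|good_s sorted_s] :=
  @sorted_steps_proper vc ec _ _ (head f (colors ec b q)) path_s.
  by rewrite last_rcons steps_s.
have [fs colors_s] : exists fs, colors ec a (rcons s b) = f :: fs.
  move: steps_s; rewrite /steps belast_rcons.
  by case: (colors _ _ _) => [|c fs] //= [->]; exists fs.
apply/and3P; split.
- rewrite -cat_cons cat_uniq uniq_q uniq_s andbT /=; apply/hasPn=> z zs.
  by apply/negP=> /qA; rewrite (disjointFr disj_sA zs).
- by rewrite /= rcons_cat cat_path last_q good_q.
rewrite /= rcons_cat path_edges_cat last_q map_cat -!/(colors _ _ _) colors_s.
by apply: cycle_cat_head sorted_q _; move: sorted_s; rewrite colors_s.
Qed.

Lemma exists_strong_setU_ear vc ec A a s b : strong e vc ec A -> ear A a s b ->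
  exists vc' ec', strong e vc' ec' (A :|: [set z in s]).
Proof.
move=> strongA ear_s; have [aA bA _ _ /and3P[_ s_neq0 _]] := and5P ear_s.
have [f [q [proper_q last_q qA sorted_q /and3P[nfa vb_af neq_vb]]]] :=
  exists_closing_path strongA aA bA.
have [t size_t walk_t] := exists_color_walk (size s).-1 C_gt3 nfa neq_vb vb_af.
rewrite prednK ?lt0n ?size_eq0 // in size_t.
have [vc' [ec' [rec steps_s]]] := exists_ear_recoloring vc ec f ear_s size_t.
have rec_vertex : {in A, vc' =1 vc} := rec.1.
have colors_q : colors ec' b q = colors ec b q.
  by rewrite (colors_recolor rec) // map_id.
exists vc', ec'.
have proper_k : proper_cycle e vc' ec' (b :: q ++ s).
  apply: (proper_cycle_closed_ear ear_s _ last_q qA) => //.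
  - exact: proper_path_recolor rec _ _ qA proper_q.
  - by rewrite colors_q; exact: sorted_q.
  - by rewrite steps_s rec_vertex.
  - by rewrite colors_q !rec_vertex //; exact: walk_t.
have strongA' := strong_recolor (@inj_id C) rec strongA.
have := strong_setU_cycle e_sym strongA' proper_k bA (mem_head _ _).
suff -> : A :|: [set z in b :: q ++ s] = A :|: [set z in s] by [].
apply/setP=> z; rewrite !in_setU !in_set -cat_cons mem_cat.
by have [//|zNA] := boolP (z \in A); rewrite (contraNF (@qA z)).
Qed.

End Ears.

Section Bridges.
Variable T : finType.
Implicit Types (e : rel T) (A : {set T}) (a b r u v x y z : T).

Definition component e r := [set x | connect e r x].

Definition remove_edge e u v : rel T := [rel x y | e x y && ([set x; y] != [set u; v])].

Definition cut_edge e u v := e u v && ~~ connect (remove_edge e u v) u v.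

Lemma remove_edge_sym e u v : symmetric e -> symmetric (remove_edge e u v).
Proof. by move=> e_sym x y; rewrite /remove_edge /= e_sym [[set x; y]]setUC. Qed.

Lemma sub_remove_edge e u v : subrel (remove_edge e u v) e.
Proof. by move=> x y /andP[]. Qed.

Lemma remove_edgeC e u v : remove_edge e u v =2 remove_edge e v u.
Proof. by move=> x y; rewrite /remove_edge /= [[set u; v]]setUC. Qed.

Lemma remove_edgeAC e a b u v :
  remove_edge (remove_edge e u v) a b =2 remove_edge (remove_edge e a b) u v.
Proof. by move=> x y; rewrite /remove_edge /= -!andbA [X in _ && X]andbC. Qed.

Lemma cut_edge_sym e u v : symmetric e -> cut_edge e u v -> cut_edge e v u.
Proof.
move=> e_sym; rewrite /cut_edge e_sym (eq_connect (remove_edgeC e v u)).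
by rewrite (sym_connect_sym (remove_edge_sym u v e_sym)).
Qed.

Lemma path_remove_edge e u v x p : path (remove_edge e u v) x p ->
  path e x p && ([set u; v] \notin path_edges x p).
Proof.
elim: p x => [//|y p IHp] x /= /andP[/andP[-> neq_xy] /IHp/andP[-> uvNp]].
by rewrite inE negb_or eq_sym neq_xy.
Qed.

Lemma connect_remove_edge e a b x y (d := remove_edge e a b) :
  connect e x y ->
  [\/ connect d x y, connect d x a /\ connect d b y | connect d x b /\ connect d a y].
Proof.
case/connectP=> p; elim: p x => [x _ ->|z p IHp x /= /andP[e_xz path_p] last_p].
  by constructor 1; apply: connect0.
have {IHp} conn_z := IHp z path_p last_p.
have [d_xz|] := boolP (d x z).
  have conn_x t : connect d z t -> connect d x t by apply/connect_trans/connect1.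
  by case: conn_z => [|[]|[]] => /conn_x;
    [constructor 1 | constructor 2 | constructor 3].
rewrite /d /remove_edge /= e_xz /= negbK eq_set2.
case/orP=> /andP[/eqP-> /eqP zE]; move: conn_z; rewrite zE => -[|[_]|[_]] conn_y.
- by constructor 2.
- by constructor 2.
- by constructor 1.
- by constructor 3.
- by constructor 1.
- by constructor 3.
Qed.

Lemma cut_edge_remove_cut_edge e a b u v : symmetric e ->
  cut_edge e a b -> cut_edge (remove_edge e a b) u v -> cut_edge e u v.
Proof.
move=> e_sym /andP[e_ab]; set d := remove_edge e a b => nab /andP[d_uv nuv].
have dC := sym_connect_sym (remove_edge_sym a b e_sym : symmetric d).
rewrite /cut_edge (sub_remove_edge d_uv) /=.
apply: contra nab => /(@connect_remove_edge _ a b).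
rewrite !(eq_connect (remove_edgeAC e a b u v)) -/d.
have conn_d x y : connect (remove_edge d u v) x y -> connect d x y.
  by apply: connect_sub => s t /sub_remove_edge/connect1.
case=> [uv|[/conn_d ua /conn_d bv]|[/conn_d ub /conn_d av]].
- by rewrite uv in nuv.
- rewrite dC in ua; rewrite dC in bv.
  exact: connect_trans ua (connect_trans (connect1 d_uv) bv).
- by apply: connect_trans av (connect_trans _ ub); rewrite dC connect1.
Qed.

Lemma component_remove_edge e a b : symmetric e -> e a b ->
  component e a = component (remove_edge e a b) a :|: component (remove_edge e a b) b.
Proof.
move=> e_sym e_ab; apply/setP=> x; rewrite !inE; apply/idP/orP.
  by case/(@connect_remove_edge _ a b) => [?|[]|[]]; [left | right | left].
have sub y : connect (remove_edge e a b) y x -> connect e y x.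
  by apply: connect_sub => u v /sub_remove_edge/connect1.
by case=> /sub // conn_b; apply: connect_trans (connect1 e_ab) conn_b.
Qed.

Lemma component_remove_cut_edge_disjoint e a b : symmetric e -> cut_edge e a b ->
  [disjoint component (remove_edge e a b) a & component (remove_edge e a b) b].
Proof.
move=> e_sym /andP[_ nab]; rewrite -setI_eq0; apply/eqP/setP=> x.
rewrite !inE; apply: contraNF nab => /andP[ax].
by rewrite (sym_connect_sym (remove_edge_sym a b e_sym)) => /(connect_trans ax).
Qed.

Lemma exists_crossing_edge e A r z : connect e r z -> r \in A -> z \notin A ->
  exists a p, [/\ a \in A, p \notin A & e a p].
Proof.
case/connectP=> p; elim: p r => [r _ -> ->//|y p IHp r /=].
move=> /andP[e_ry path_p] last_p rA zA.
by have [yA|yA] := boolP (y \in A); [apply: IHp yA zA | exists r, y].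
Qed.

Lemma exists_ear e A r : symmetric e ->
  {in component e r, forall x y, ~~ cut_edge e x y} ->
  r \in A -> A \proper component e r -> exists a b s, ear e A a s b.
Proof.
move=> e_sym bridgeless rA /properP[/subsetP sub [z]]; rewrite inE => rz zA.
have [a [p [aA pNA e_ap]]] := exists_crossing_edge rz rA zA.
have := bridgeless a (sub a aA) p; rewrite /cut_edge e_ap negbK.
rewrite (sym_connect_sym (remove_edge_sym a p e_sym)) => /connectP[q' path_q' last_q'].
case/shortenP: path_q' last_q' => q path_q uniq_q _ last_q.
have hit : has (mem A) q.
  apply/hasP; exists a => //; have : a \in p :: q by rewrite last_q mem_last.
  by rewrite inE => /predU1P[ap|//]; rewrite -ap aA in pNA.
case: (split_find hit) path_q uniq_q {last_q} => b s q2 bA sNA; rewrite /= in bA.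
rewrite cat_path -cat_cons cat_uniq -rcons_cons.
move=> /andP[/path_remove_edge/andP[path_s apNs] _] /andP[uniq_s _].
exists a, b, (p :: s); rewrite /ear aA bA rcons_cons /= e_ap path_s.
rewrite apNs path_edges_uniq //= andbT.
move: uniq_s; rewrite rcons_uniq => /andP[_ /= ->] /=.
by rewrite disjoint_cons pNA disjoint_has.
Qed.

End Bridges.

Section JoiningAcrossEdge.
Variables (T : finType) (C : eqType) (e : rel T).
Variables (vc : T -> C) (ec : {set T} -> C) (A B : {set T}) (a b : T).
Hypotheses (e_sym : symmetric e) (disjAB : [disjoint A & B]).
Hypotheses (aA : a \in A) (bB : b \in B).
Hypothesis good_ab : good_edge e vc ec a b.
Hypotheses (missing_a : missing e vc ec A (ec [set a; b]) a)
  (missing_b : missing e vc ec B (ec [set a; b]) b).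

Lemma joined_across_edge x y :
  joined e vc ec A x a -> joined e vc ec B y b -> joined e vc ec (A :|: B) x y.
Proof.
move=> [p [proper_p last_p pA]] [q [proper_q last_q qB]].
have proper_pb : proper_path e vc ec x (rcons p b).
  by apply: proper_path_rcons proper_p pA _ _ _; rewrite ?last_p ?(disjointFl disjAB).
have : proper_path e vc ec y (rcons q a).
  apply: proper_path_rcons proper_q qB _ _ _; rewrite ?last_q ?(disjointFr disjAB) //.
    by rewrite good_edge_sym.
  by rewrite setUC.
move/(proper_path_rev e_sym); rewrite last_rcons belast_rcons lastI rev_rcons last_q.
set q' := rev (belast y q) => proper_abq.
have q'B z : z \in b :: q' -> z \in B by rewrite -last_q mem_rev_belast => /qB.
exists (p ++ b :: q'); split.
- apply: proper_path_overlap proper_pb _ _; first by rewrite last_p.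
  rewrite disjoint_has; apply/hasPn=> z /pA zA; apply/negP=> /q'B.
  by rewrite (disjointFr disjAB).
- by rewrite last_cat /= /q' -last_q last_rev_belast.
- by move=> z; rewrite -cat_cons mem_cat in_setU => /orP[/pA->//|/q'B->]; rewrite orbT.
Qed.

Lemma proper_connected_setU_edge : proper_connected e vc ec A ->
  proper_connected e vc ec B -> proper_connected e vc ec (A :|: B).
Proof.
move=> connA connB.
have across x y : x \in A -> y \in B -> joined e vc ec (A :|: B) x y.
  by move=> xA yB; apply: joined_across_edge; [apply: connA | apply: connB].
move=> x y /setUP[xA|xB] /setUP[yA|yB].
- by apply: joined_subset (subsetUl _ _) _; apply: connA.
- exact: across.
- by apply: joined_sym => //; apply: across.
- by apply: joined_subset (subsetUr _ _) _; apply: connB.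
Qed.

End JoiningAcrossEdge.

Section ColoringBridges.
Variables (T C : finType) (e : rel T).
Hypotheses (e_sym : symmetric e) (C_gt2 : 2 < #|C|).
Implicit Types (vc : T -> C) (ec : {set T} -> C) (A B : {set T}).

Lemma exists_missing vc ec A x : #|[set y in A | e x y]|.+1 < #|C| ->
  exists c, missing e vc ec A c x.
Proof.
set N := [set y in A | e x y] => small.
have [|c] := @exists_notin C (vc x :: [seq ec [set y; x] | y in N]).
  by rewrite /= size_image.
rewrite inE negb_or => /andP[ncx cN]; exists c; split=> // y yA e_yx.
apply: contraNneq cN => <-; apply/imageP; exists y => //.
by rewrite inE yA e_sym.
Qed.

Lemma exists_merged_coloring A B a b k sg vc1 ec1 vc2 ec2 :
  [disjoint A & B] -> a \in A -> b \in B -> exists vc ec,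
  [/\ recolors id A vc1 ec1 vc ec, recolors sg B vc2 ec2 vc ec & ec [set a; b] = k].
Proof.
move=> disjAB aA bB.
have neq_ab (S : {set T}) u x y :
    u \in [set a; b] -> u \notin S -> x \in S -> y \in S ->
    ([set x; y] == [set a; b]) = false.
  move=> u_ab uNS xS yS; apply: contraNF uNS => /eqP eq_ab.
  by move: u_ab; rewrite -eq_ab !inE => /orP[]/eqP->.
exists (fun x => if x \in B then sg (vc2 x) else vc1 x).
exists [eta fun S : {set T} => if S \subset B then sg (ec2 S) else ec1 S
  with [set a; b] |-> k].
split; last by rewrite /= eqxx.
- split=> [x xA | x y xA yA] /=; first by rewrite (disjointFr disjAB).
  rewrite (neq_ab A b) ?set22 ?(disjointFl disjAB bB) //.
  by rewrite subUset !sub1set (disjointFr disjAB xA).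
split=> [x xB | x y xB yB] /=; first by rewrite xB.
rewrite (neq_ab B a) ?set21 ?(disjointFr disjAB aA) //.
by rewrite subUset !sub1set xB yB.
Qed.

Lemma exists_bridge_coloring A B a b vc1 ec1 vc2 ec2 :
  [disjoint A & B] -> proper_connected e vc1 ec1 A -> proper_connected e vc2 ec2 B ->
  a \in A -> b \in B -> e a b ->
  #|[set y | e a y]| < #|C| -> #|[set y | e b y]| < #|C| ->
  exists vc ec, proper_connected e vc ec (A :|: B).
Proof.
move=> disjAB connA connB aA bB e_ab deg_a deg_b.
have deg_within (S : {set T}) x y : y \notin S -> e x y -> #|[set y | e x y]| < #|C| ->
    #|[set y in S | e x y]|.+1 < #|C|.
  move=> yNS e_xy; apply: leq_ltn_trans; apply/proper_card/properP; split.
    by apply/subsetP=> z; rewrite !inE => /andP[].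
  by exists y; rewrite !inE // (negPf yNS).
have [|k1 missing1] := @exists_missing vc1 ec1 A a.
  by apply: (deg_within _ _ b); rewrite ?(disjointFl disjAB).
have [|k2 missing2] := @exists_missing vc2 ec2 B b.
  by apply: (deg_within _ _ a); rewrite ?(disjointFr disjAB) // e_sym.
have [c] := @exists_notin C [:: k1; vc1 a] C_gt2.
rewrite !inE negb_or => /andP[nck nca].
have nkc : k1 != c by rewrite eq_sym.
have [sg sg_k sg_b] := exists_perm2 missing2.1 nkc.
have [vc [ec [recA recB ec_ab]]] :=
  exists_merged_coloring k1 sg vc1 ec1 vc2 ec2 disjAB aA bB.
have vc_a : vc a = vc1 a by apply: recA.1.
have vc_b : vc b = c by rewrite recB.1 //= sg_b.
exists vc, ec; apply: (proper_connected_setU_edge e_sym disjAB aA bB).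
- by rewrite /good_edge /= e_ab ec_ab vc_a vc_b eq_sym nca nkc missing1.1.
- by rewrite ec_ab; apply: (missing_recolor (@inj_id C) recA aA missing1).
- by rewrite ec_ab -sg_k; apply: (missing_recolor (@perm_inj _ sg) recB bB missing2).
- exact: proper_connected_recolor (@inj_id C) recA connA.
- exact: proper_connected_recolor (@perm_inj _ sg) recB connB.
Qed.

End ColoringBridges.

Section ColoringComponents.
Variables (T C : finType).
Hypothesis C_gt3 : 3 < #|C|.
Implicit Types (e : rel T) (r : T).

Lemma exists_strong_coloring e r : symmetric e ->
  {in component e r, forall x y, ~~ cut_edge e x y} ->
  exists (vc : T -> C) ec, strong e vc ec (component e r).
Proof.
move=> e_sym bridgeless; have /card_gt0P[c _] : 0 < #|C| by apply: leq_trans C_gt3.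
pose colorable (S : {set T}) := exists (vc : T -> C) ec, strong e vc ec S.
apply: (@set_growth_ind _ colorable [set r]).
- by rewrite sub1set inE.
- by exists (fun=> c), (fun=> c) => x y /set1P-> /set1P->; rewrite eqxx.
move=> A; rewrite sub1set => rA ltA [vc [ec strongA]].
have [a [b [s ear_s]]] := exists_ear e_sym bridgeless rA ltA.
have /and5P[aA _ path_s _ _] := ear_s.
exists (A :|: [set z in s]); split.
- exact: ear_proper ear_s.
- rewrite subUset proper_sub //; apply/subsetP=> z; rewrite !inE => zs.
  have /subsetP/(_ a aA) := proper_sub ltA; rewrite inE => /connect_trans; apply.
  by apply: (path_connect path_s); rewrite inE mem_rcons inE zs !orbT.
- exact: exists_strong_setU_ear strongA ear_s.
Qed.

Lemma exists_proper_connected_coloring e r : symmetric e ->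
  (forall x y, cut_edge e x y -> #|[set z | e x z]| < #|C|) ->
  exists (vc : T -> C) ec, proper_connected e vc ec (component e r).
Proof.
have [n] := ubnP #|[set uv : T * T | e uv.1 uv.2]|.
elim: n e r => // n IHn e r; rewrite ltnS => le_n e_sym deg_lt.
have [/existsP[a /existsP[b /andP[ra cut_ab]]]|bridgeless] :=
  boolP [exists a, exists b, connect e r a && cut_edge e a b]; last first.
  have [|vc [ec strong_comp]] := @exists_strong_coloring e r e_sym.
    move=> a; rewrite inE => ra b; apply: contra bridgeless => cut_ab.
    by apply/existsP; exists a; apply/existsP; exists b; rewrite ra.
  by exists vc, ec; apply: strong_proper_connected.
have [e_ab _] := andP cut_ab; set d := remove_edge e a b.
have d_sym : symmetric d by apply: remove_edge_sym.
have sub_d_e : subrel d e := @sub_remove_edge _ e a b.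
have dn : #|[set uv : T * T | d uv.1 uv.2]| < n.
  apply: leq_trans le_n; apply/proper_card/properP; split.
    by apply/subsetP=> uv; rewrite !inE => /sub_d_e.
  by exists (a, b); rewrite inE //= /d /remove_edge /= eqxx andbF.
have deg_lt_d x y : cut_edge d x y -> #|[set z | d x z]| < #|C|.
  move/(cut_edge_remove_cut_edge e_sym cut_ab)/deg_lt; apply: leq_ltn_trans.
  by apply/subset_leq_card/subsetP=> z; rewrite !inE => /sub_d_e.
have [vc1 [ec1 conn_a]] := IHn d a dn d_sym deg_lt_d.
have [vc2 [ec2 conn_b]] := IHn d b dn d_sym deg_lt_d.
have -> : component e r = component d a :|: component d b.
  rewrite -component_remove_edge //; apply/setP=> x.
  by rewrite !inE (same_connect (sym_connect_sym e_sym) ra).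
apply: (exists_bridge_coloring e_sym (ltnW C_gt3) _ _ _ _ _ e_ab).
- exact: component_remove_cut_edge_disjoint.
- exact: proper_connected_subrel sub_d_e conn_a.
- exact: proper_connected_subrel sub_d_e conn_b.
- by rewrite inE.
- by rewrite inE.
- exact: deg_lt cut_ab.
- exact: deg_lt (cut_edge_sym e_sym cut_ab).
Qed.

End ColoringComponents.

Lemma cut_edge_bridge (G : sgraph) (u v : G) : gconnected G ->
  cut_edge (@sedge G) u v -> bridge u v.
Proof.
move=> [_ conn] /andP[e_uv nuv]; rewrite /bridge e_uv /=.
have e_sym := @sedge_sym G.
have -> : n_comp (@sedge G) predT = 1.
  rewrite -(n_comp_connect (sym_connect_sym e_sym) u); apply: eq_n_comp_r => x.
  by rewrite [RHS]conn.
have := n_comp_closure2 (sym_connect_sym (remove_edge_sym u v e_sym)) u v.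
rewrite nuv => <-; apply/subset_leq_card/subsetP=> x.
by rewrite !inE => /andP[-> _]; rewrite andbT.
Qed.

Lemma proper_path_total_proper (G : sgraph) (C : eqType) (c : total_coloring G C) x p :
  proper_path (@sedge G) (vcol c) (ecol c) x p -> total_proper_path c x p.
Proof.
case/and3P=> good_p uniq_p sorted_p; have goodP := pathP x good_p.
have path_p : path (@sedge G) x p by apply: sub_path good_p => u v /and4P[].
split; first by rewrite path_p.
- move=> i /=; rewrite !ltnS => lt_i.
  have := sortedP (ecol c set0) sorted_p.
  rewrite size_map size_pairmap => /(_ i lt_i).
  rewrite /distinct /colors !(nth_map set0) ?size_pairmap ?(ltnW lt_i) //.
  by rewrite !(nth_pairmap x) // ltnW.
- move=> i _ /=; rewrite !ltnS => lt_i.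
  by have /and4P[] := goodP i (ltnW lt_i).
- move=> i /=; rewrite !ltnS => lt_i.
  have /and4P[_ _ _ neq_in] := goodP i (ltnW lt_i).
  have /and4P[_ _ neq_out _] := goodP i.+1 lt_i.
  by rewrite ![vcol c _ == _]eq_sym.
Qed.

Lemma tpc_le (G : sgraph) (hG : gconnected G) k :
  3 < k -> bridge_max_degree G < k -> tpc hG <= k.
Proof.
move=> k_gt3 deg_lt; rewrite /tpc; case: ex_minnP => m _; apply; apply/asboolP.
have [/card_gt0P[r _] conn] := hG.
have [||vc [ec conn_r]] :=
  @exists_proper_connected_coloring G 'I_k _ _ r (@sedge_sym G).
- by rewrite card_ord.
- move=> x y /(cut_edge_bridge hG) bridge_xy.
  rewrite card_ord; apply: leq_ltn_trans deg_lt.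
  by apply: (@leq_bigmax_cond _ _ (@degree G)); apply/existsP; exists y.
exists (TotalColoring vc ec) => x y _.
have [||p [proper_p last_p _]] := conn_r x y; rewrite ?inE ?conn //.
by exists p; split=> //; apply: proper_path_total_proper.
Qed.

Theorem theorem4 (G : sgraph) (hG : gconnected G) :
  (4 <= bridge_max_degree G -> tpc hG <= bridge_max_degree G + 1) /\
  (bridge_max_degree G < 4 -> tpc hG <= 4).
Proof.
split=> h; last exact: tpc_le.
by apply: tpc_le; rewrite addn1 // ltnS; apply: ltnW.
Qed.
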